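(* Let $k$ be an algebraically closed field of characteristic $p>0$, let $(\mathfrak{g},[p])$ be a finite-dimensional $p$-trivial restricted Lie algebra over $k$ (i.e. $x^{[p]}=0$ for all $x\in\mathfrak{g}$), and let $M$ be a finite-dimensional $U_0(\mathfrak{g})$-module of constant rank. If there exist linearly independent elements $x,y\in\mathfrak{g}\setminus\{0\}$ such that $\mathrm{im}\,x_M=\mathrm{im}\,y_M$, then $M$ has the equal images property.
   Context: $U_0(\mathfrak{g})=U(\mathfrak{g})/(\{x^p-x^{[p]} : x\in\mathfrak{g}\})$ is the restricted enveloping algebra. For $x\in\mathfrak{g}$, $x_M:M\to M$ is the operator $m\mapsto x.m$. For $p$-trivial $\mathfrak{g}$: $M$ has constant rank if $\mathrm{rk}(x_M)=\mathrm{rk}(y_M)$ for all $x,y\in\mathfrak{g}\setminus\{0\}$; $M$ has the equal images property if $\mathrm{im}\,x_M^j=\mathrm{im}\,y_M^j$ for all $x,y\in\mathfrak{g}\setminus\{0\}$ and all $j\in\{1,\ldots,p-1\}$. *)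

(* Defs.v *)
From HB Require Import structures.
From mathcomp Require Import all_boot all_order all_algebra.
From mathcomp Require Import boolp.
From mathcomp Require Import ring_quotient generic_quotient.
From mathcomp Require Import monalg.

Set Implicit Arguments.
Unset Strict Implicit.
Unset Printing Implicit Defensive.

Import GRing.Theory.
Local Open Scope ring_scope.
Local Open Scope quotient_scope.

Record lieAlgebra (k : fieldType) := LieAlgebra {
  lie_sort :> vectType k;
  bracket : lie_sort -> lie_sort -> lie_sort;
  bracket_linl : forall y, linear (bracket^~ y);
  bracket_linr : forall x, linear (bracket x);
  bracket_alt : forall x, bracket x x = 0;
  bracket_jacobi : forall x y z,
    bracket x (bracket y z) + bracket y (bracket z x)
      + bracket z (bracket x y) = 0
}.

(* [ad_coef x y n i] is the coefficient of T^i in ad(x T + y)^n (x), computed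
   in g[T]. *)
Fixpoint ad_coef (k : fieldType) (g : lieAlgebra k) (x y : g) (n i : nat) : g :=
  match n, i with
  | 0, 0 => x
  | 0, _.+1 => 0
  | n'.+1, 0 => bracket y (ad_coef x y n' 0)
  | n'.+1, i'.+1 =>
      bracket y (ad_coef x y n' i'.+1) + bracket x (ad_coef x y n' i')
  end.

(* Jacobson's terms: i s_i(x, y) is the coefficient of T^(i-1) in
   ad(x T + y)^(p-1) (x), for 1 <= i <= p - 1. *)
Definition jacobson_s (k : fieldType) (g : lieAlgebra k) (p : nat) (x y : g)
  (i : nat) : g := (i%:R : k)^-1 *: ad_coef x y p.-1 i.-1.

Record restrictedLieAlgebra (k : fieldType) (p : nat) := RestrictedLieAlgebra {
  res_lie :> lieAlgebra k;
  res_char : p \in [pchar k];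
  p_power : res_lie -> res_lie;
  p_power_ad : forall x y, bracket (p_power x) y = iter p (bracket x) y;
  p_powerZ : forall (a : k) x, p_power (a *: x) = a ^+ p *: p_power x;
  p_powerD : forall x y, p_power (x + y)
            = p_power x + p_power y + \sum_(1 <= i < p) jacobson_s p x y i
}.

Definition p_trivial (k : fieldType) (p : nat) (g : restrictedLieAlgebra k p) :=
  forall x : g, p_power x = 0.

Section GeneratedIdeal.
Variables (k : fieldType) (A : algType k).

(* Closure under scaling comes from multiplication by the scalars c%:A. *)
Inductive gen_ideal (S : A -> Prop) : A -> Prop :=
| gen_ideal_in a : S a -> gen_ideal S a
| gen_ideal0 : gen_ideal S 0
| gen_idealD a b : gen_ideal S a -> gen_ideal S b -> gen_ideal S (a + b)
| gen_idealMl a b : gen_ideal S b -> gen_ideal S (a * b)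
| gen_idealMr a b : gen_ideal S a -> gen_ideal S (a * b).

Definition gen_idealb (S : A -> Prop) : {pred A} := fun a => `[< gen_ideal S a >].

Lemma gen_idealP S a : reflect (gen_ideal S a) (a \in gen_idealb S).
Proof. exact: asboolP. Qed.

Lemma gen_idealN S a : gen_ideal S a -> gen_ideal S (- a).
Proof. by rewrite -mulN1r; apply: gen_idealMl. Qed.

Lemma gen_idealb_zmod S : zmod_closed (gen_idealb S).
Proof.
split; first by apply/gen_idealP/gen_ideal0.
move=> a b /gen_idealP Ia /gen_idealP Ib; apply/gen_idealP.
by apply: gen_idealD => //; apply: gen_idealN.
Qed.

HB.instance Definition _ S :=
  GRing.isZmodClosed.Build A (gen_idealb S) (gen_idealb_zmod S).

End GeneratedIdeal.

(* MathComp algebras are nonzero, hence the argument [nS]. *)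
Definition quot_alg (k : fieldType) (A : algType k) (S : A -> Prop)
    (nS : ~ gen_ideal S 1) : Type :=
  Quotient.quot (gen_idealb S : zmodClosed A).

Section QuotAlg.
Variables (k : fieldType) (A : algType k) (S : A -> Prop).
Variable nS : ~ gen_ideal S 1.
Local Notation Q := (quot_alg nS).

HB.instance Definition _ := GRing.Zmodule.on Q.

Definition quot_pi (a : A) : Q :=
  \pi_(Quotient.quot (gen_idealb S : zmodClosed A)) a.
Definition quot_repr (u : Q) : A :=
  repr (u : Quotient.quot (gen_idealb S : zmodClosed A)).

Lemma quot_reprK u : quot_pi (quot_repr u) = u.
Proof. exact: reprK. Qed.

Lemma quot_pi_eq a b : (quot_pi a = quot_pi b) <-> gen_ideal S (a - b).
Proof.
split.
  by move=> e; apply/gen_idealP; rewrite Quotient.idealrBE; apply/eqP.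
by move=> /gen_idealP; rewrite Quotient.idealrBE => /eqP.
Qed.

Lemma quot_repr_pi a : gen_ideal S (quot_repr (quot_pi a) - a).
Proof. by apply/quot_pi_eq; rewrite quot_reprK. Qed.

Lemma quot_pi_zmod_morphism : zmod_morphism quot_pi.
Proof. by move=> a b; rewrite /quot_pi raddfB. Qed.

HB.instance Definition _ :=
  GRing.isZmodMorphism.Build A Q quot_pi quot_pi_zmod_morphism.

Definition quot_one : Q := quot_pi 1.
Definition quot_mul : Q -> Q -> Q :=
  locked (fun u v => quot_pi (quot_repr u * quot_repr v)).
Definition quot_scale : k -> Q -> Q :=
  locked (fun c u => quot_pi (c *: quot_repr u)).

Lemma quot_mulE a b : quot_mul (quot_pi a) (quot_pi b) = quot_pi (a * b).
Proof.
rewrite /quot_mul -lock; apply/quot_pi_eq; set a' := quot_repr _; set b' := quot_repr _.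
have ->: a' * b' - a * b = (a' - a) * b' + a * (b' - b).
  by rewrite mulrBl mulrBr addrA subrK.
by apply: gen_idealD; [apply: gen_idealMr|apply: gen_idealMl];
  apply: quot_repr_pi.
Qed.

Lemma quot_scaleE c a : quot_scale c (quot_pi a) = quot_pi (c *: a).
Proof.
rewrite /quot_scale -lock; apply/quot_pi_eq; rewrite -scalerBr -[X in c *: X]mul1r scalerAl.
by apply: gen_idealMl; apply: quot_repr_pi.
Qed.

Lemma quot_mulA : associative quot_mul.
Proof.
move=> u v w; rewrite -(quot_reprK u) -(quot_reprK v) -(quot_reprK w).
by rewrite !quot_mulE mulrA.
Qed.

Lemma quot_mul1 : left_id quot_one quot_mul.
Proof. by move=> u; rewrite -(quot_reprK u) quot_mulE mul1r. Qed.

Lemma quot_mulr1 : right_id quot_one quot_mul.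
Proof. by move=> u; rewrite -(quot_reprK u) quot_mulE mulr1. Qed.

Lemma quot_mulDl : left_distributive quot_mul +%R.
Proof.
move=> u v w; rewrite -(quot_reprK u) -(quot_reprK v) -(quot_reprK w).
by rewrite -raddfD !quot_mulE mulrDl raddfD.
Qed.

Lemma quot_mulDr : right_distributive quot_mul +%R.
Proof.
move=> u v w; rewrite -(quot_reprK u) -(quot_reprK v) -(quot_reprK w).
by rewrite -raddfD !quot_mulE mulrDr raddfD.
Qed.

Lemma quot_one_neq0 : quot_one != 0.
Proof.
apply/eqP; rewrite -(raddf0 quot_pi) => /quot_pi_eq.
by rewrite subr0.
Qed.

HB.instance Definition _ := GRing.Zmodule_isNzRing.Build Q
  quot_mulA quot_mul1 quot_mulr1 quot_mulDl quot_mulDr quot_one_neq0.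

Lemma quot_scaleA a b u : quot_scale a (quot_scale b u) = quot_scale (a * b) u.
Proof. by rewrite -(quot_reprK u) !quot_scaleE scalerA. Qed.

Lemma quot_scale1 : left_id 1 quot_scale.
Proof. by move=> u; rewrite -(quot_reprK u) quot_scaleE scale1r. Qed.

Lemma quot_scaleDr : right_distributive quot_scale +%R.
Proof.
move=> a u v; rewrite -(quot_reprK u) -(quot_reprK v).
by rewrite -raddfD !quot_scaleE scalerDr raddfD.
Qed.

Lemma quot_scaleDl u : {morph quot_scale^~ u : a b / a + b}.
Proof.
by move=> a b; rewrite -(quot_reprK u) !quot_scaleE scalerDl raddfD.
Qed.

HB.instance Definition _ := GRing.Zmodule_isLmodule.Build k Q
  quot_scaleA quot_scale1 quot_scaleDr quot_scaleDl.

Lemma quot_scaleAl (a : k) (u v : Q) : a *: (u * v) = (a *: u) * v.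
Proof.
have mE x y : quot_pi x * quot_pi y = quot_pi (x * y) := quot_mulE x y.
have sE c x : c *: quot_pi x = quot_pi (c *: x) := quot_scaleE c x.
rewrite -(quot_reprK u) -(quot_reprK v).
by move: (quot_repr u) (quot_repr v) => x y; rewrite (sE a x) !mE sE scalerAl.
Qed.

HB.instance Definition _ := GRing.Lmodule_isLalgebra.Build k Q quot_scaleAl.

Lemma quot_scaleAr (a : k) (u v : Q) : a *: (u * v) = u * (a *: v).
Proof.
have mE x y : quot_pi x * quot_pi y = quot_pi (x * y) := quot_mulE x y.
have sE c x : c *: quot_pi x = quot_pi (c *: x) := quot_scaleE c x.
rewrite -(quot_reprK u) -(quot_reprK v).
by move: (quot_repr u) (quot_repr v) => x y; rewrite (sE a y) !mE sE scalerAr.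
Qed.

HB.instance Definition _ := GRing.Lalgebra_isAlgebra.Build k Q quot_scaleAr.

Lemma quot_pi_monoid_morphism : monoid_morphism quot_pi.
Proof. by split=> [|a b] //; exact/esym/quot_mulE. Qed.

Lemma quot_pi_scalable : scalable quot_pi.
Proof. by move=> c a; exact/esym/quot_scaleE. Qed.

HB.instance Definition _ :=
  GRing.isMonoidMorphism.Build A Q quot_pi quot_pi_monoid_morphism.
HB.instance Definition _ :=
  GRing.isScalable.Build k A Q *:%R quot_pi quot_pi_scalable.

Section Lift.
Variables (B : nzRingType) (f : {rmorphism A -> B}).
Hypothesis fS : forall a, S a -> f a = 0.

Lemma gen_ideal_ker a : gen_ideal S a -> f a = 0.
Proof.
elim=> {a} [a /fS //||a b _ ea _ eb|a b _ e|a b _ e]; first exact: rmorph0.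
- by rewrite rmorphD ea eb addr0.
- by rewrite rmorphM e mulr0.
- by rewrite rmorphM e mul0r.
Qed.

Definition quot_lift of (forall a, S a -> f a = 0) : Q -> B :=
  fun u => f (quot_repr u).

Lemma quot_lift_pi a : quot_lift fS (quot_pi a) = f a.
Proof.
by apply/eqP; rewrite -subr_eq0 -rmorphB gen_ideal_ker//; apply: quot_repr_pi.
Qed.

Lemma quot_lift_zmod_morphism : zmod_morphism (quot_lift fS).
Proof.
move=> u v; rewrite -(quot_reprK u) -(quot_reprK v) -raddfB.
by rewrite !quot_lift_pi rmorphB.
Qed.

Lemma quot_lift_monoid_morphism : monoid_morphism (quot_lift fS).
Proof.
split=> [|u v]; first by rewrite quot_lift_pi rmorph1.
rewrite -(quot_reprK u) -(quot_reprK v) -rmorphM.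
by rewrite !quot_lift_pi rmorphM.
Qed.

HB.instance Definition _ := GRing.isZmodMorphism.Build Q B (quot_lift fS)
  quot_lift_zmod_morphism.
HB.instance Definition _ := GRing.isMonoidMorphism.Build Q B (quot_lift fS)
  quot_lift_monoid_morphism.

End Lift.

End QuotAlg.

Lemma gen_ideal_proper (k : fieldType) (A : algType k) (S : A -> Prop)
    (B : nzRingType) (f : {rmorphism A -> B}) :
  (forall a, S a -> f a = 0) -> ~ gen_ideal S 1.
Proof.
by move=> fS /(gen_ideal_ker fS)/eqP; rewrite rmorph1 oner_eq0.
Qed.

Lemma malg_scaleAr (k : fieldType) (K : monomType) (c : k) (u v : {malg k[K]}) :
  c *: (u * v) = u * (c *: v).
Proof.
apply/malgP => m; rewrite mcoeffZ (mcoeffMl u v) mulr_sumr.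
rewrite (@mcoeffMlw _ _ (msupp u) (msupp v)) ?msuppZ_le //.
apply: eq_bigr => m1 _; rewrite mulr_sumr; apply: eq_bigr => m2 _.
by rewrite mcoeffZ mulrnAr mulrCA.
Qed.

(* Noncommutative polynomials with variables indexed by the elements of [I];
   an alias, since [malg] has an algebra instance in the commutative case only. *)
Definition free_alg (k : fieldType) (I : choiceType) : Type :=
  {malg k[{fmonom I}]}.

Section FreeAlgebra.
Variables (k : fieldType) (I : choiceType).

HB.instance Definition _ := GRing.Lalgebra.on (free_alg k I).

Lemma free_scaleAr (c : k) (u v : free_alg k I) : c *: (u * v) = u * (c *: v).
Proof. exact: malg_scaleAr. Qed.

HB.instance Definition _ :=
  GRing.Lalgebra_isAlgebra.Build k (free_alg k I) free_scaleAr.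

Definition free_var (x : I) : free_alg k I := << fmu x >>.

Definition free_aug : free_alg k I -> k :=
  (@mcoeff {fmonom I} k (@fmone I) : {malg k[{fmonom I}]} -> k).

HB.instance Definition _ := GRing.RMorphism.copy free_aug
  (@mcoeff {fmonom I} k (@fmone I) : {malg k[{fmonom I}]} -> k).

Lemma free_aug_var (x : I) : free_aug (free_var x) = 0.
Proof. by rewrite /free_aug /free_var mcoeffU1 fm1_eq1. Qed.

Lemma free_augZ (c : k) (u : free_alg k I) : free_aug (c *: u) = c * free_aug u.
Proof. exact: mcoeffZ. Qed.

End FreeAlgebra.

Lemma rmorph_comm_sub0 (R S : nzRingType) (f : {rmorphism R -> S}) (x y z : R) :
  f x = 0 -> f y = 0 -> f z = 0 -> f (x * y - y * x - z) = 0.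
Proof. by move=> fx fy fz; rewrite !rmorphB !rmorphM fx fy fz mulr0 !subr0. Qed.

Lemma rmorph_comm_sub (R S : nzRingType) (f : {rmorphism R -> S}) (x y : R) :
  f (x * y - y * x) = f x * f y - f y * f x.
Proof. by rewrite rmorphB !rmorphM. Qed.

(* U(g) = T(g) / (x y - y x - [x, y]), where T(g) is in turn the free algebra on
   the set g modulo the linearity of the generators. *)
Section Enveloping.
Variables (k : fieldType) (g : lieAlgebra k).
Local Notation X := (@free_var k g).

Inductive env_rel : free_alg k g -> Prop :=
| env_rel_lin (a : k) (x y : g) : env_rel (X (a *: x + y) - (a *: X x + X y))
| env_rel_bracket (x y : g) :
    env_rel (X x * X y - X y * X x - X (bracket x y)).

Lemma env_rel_aug a : env_rel a -> free_aug a = 0.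
Proof.
case=> [c x y|x y].
  by rewrite rmorphB rmorphD /= free_augZ !free_aug_var mulr0 addr0 subr0.
by apply: rmorph_comm_sub0 => //; apply: free_aug_var.
Qed.

Definition env_alg : algType k := quot_alg (gen_ideal_proper env_rel_aug).

Definition env_in (x : g) : env_alg := quot_pi _ (X x).

Lemma env_in_linear : linear env_in.
Proof.
move=> a x y; apply: etrans (linearP (quot_pi _) a (X x) (X y)).
by apply/quot_pi_eq/gen_ideal_in; apply: env_rel_lin.
Qed.

Lemma env_in_bracket (x y : g) :
  env_in (bracket x y) = env_in x * env_in y - env_in y * env_in x.
Proof.
apply: etrans (rmorph_comm_sub (quot_pi _) (X x) (X y)).
by apply/esym/quot_pi_eq/gen_ideal_in; apply: env_rel_bracket.
Qed.

Definition env_aug : {rmorphism env_alg -> k} :=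
  quot_lift (nS := gen_ideal_proper env_rel_aug) env_rel_aug.

Lemma env_aug_in x : env_aug (env_in x) = 0.
Proof. exact: etrans (quot_lift_pi _ _ _) (free_aug_var _ _). Qed.

End Enveloping.

Section RestrictedEnveloping.
Variables (k : fieldType) (p : nat) (g : restrictedLieAlgebra k p).

Inductive res_env_rel : env_alg g -> Prop :=
| res_env_rel_p (x : g) : res_env_rel (env_in x ^+ p - env_in (p_power x)).

Lemma res_env_rel_aug a : res_env_rel a -> env_aug g a = 0.
Proof.
have p_gt0 : (0 < p)%N by apply: prime_gt0; case/andP: (res_char g).
case=> x; rewrite rmorphB rmorphXn !env_aug_in expr0n.
by rewrite gtn_eqF // subr0.
Qed.

(* U_0(g) = U(g) / (x^p - x^[p]). *)
Definition res_env_alg : algType k := quot_alg (gen_ideal_proper res_env_rel_aug).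

Definition res_env_in (x : g) : res_env_alg := quot_pi _ (env_in x).

Local Notation pi := (quot_pi (gen_ideal_proper res_env_rel_aug)).

Lemma res_env_in_linear : linear res_env_in.
Proof.
move=> a x y; rewrite /res_env_in env_in_linear.
exact: (linearP pi).
Qed.

Lemma res_env_in_bracket (x y : g) :
  res_env_in (bracket x y)
    = res_env_in x * res_env_in y - res_env_in y * res_env_in x.
Proof.
rewrite /res_env_in env_in_bracket.
exact: (rmorph_comm_sub pi).
Qed.

Lemma res_env_in_p (x : g) : res_env_in x ^+ p = res_env_in (p_power x).
Proof.
rewrite /res_env_in -(rmorphXn pi); apply/quot_pi_eq/gen_ideal_in.
exact: res_env_rel_p.
Qed.

End RestrictedEnveloping.

Record fdModule (k : fieldType) (A : algType k) := FdModule {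
  fd_sort :> vectType k;
  fd_act : A -> fd_sort -> fd_sort;
  fd_act_linl : forall m, linear (fd_act^~ m);
  fd_act_linr : forall a, linear (fd_act a);
  fd_act1 : forall m, fd_act 1 m = m;
  fd_actM : forall a b m, fd_act (a * b) m = fd_act a (fd_act b m)
}.

HB.instance Definition _ (k : fieldType) (A : algType k) (M : fdModule A)
    (a : A) :=
  GRing.isLinear.Build k M M *:%R (fd_act a) (@fd_act_linr k A M a).

Section Modules.
Variables (k : fieldType) (p : nat) (g : restrictedLieAlgebra k p).
Variable M : fdModule (res_env_alg g).

Definition opM (x : g) : 'End(M) := linfun (fd_act (res_env_in x)).

Definition opM_exp (x : g) (j : nat) : 'End(M) :=
  iter j (fun f => opM x \o f)%VF \1%VF.

Definition constant_rank :=
  forall x y : g, x != 0 -> y != 0 ->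
    \dim (limg (opM x)) = \dim (limg (opM y)).

Definition equal_images_property :=
  forall (x y : g) (j : nat), x != 0 -> y != 0 -> (1 <= j <= p.-1)%N ->
    limg (opM_exp x j) = limg (opM_exp y j).

End Modules.

(* Main.v *)
(* Geometrically, z |-> im z_M is a morphism from P(g) to a Grassmannian which
   contracts the line through x and y, so it is constant. Concretely, z_M maps
   the kernel of every nonzero a x_M + b y_M into V := im x_M, by the
   description of tangent spaces to rank varieties. A functional on M that
   vanishes on V, composed with z_M, thus factors through a x_M + b y_M for all
   (a, b); the factor is a section of a sum of copies of O(-1) on the line,
   so it is zero, and im z_M is contained in V.
   By Engel's theorem g has a nonzero central element c, and induction on j
   gives x^(j+1) M = x c^j M = c^j x M = c^j c M = c^(j+1) M. *)
From HB Require Import structures.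
Require Import Defs.
From mathcomp Require Import all_boot all_order all_algebra.

Set Implicit Arguments.
Unset Strict Implicit.
Unset Printing Implicit Defensive.

Import GRing.Theory.
Local Open Scope ring_scope.

Section Pencils.
Variable k : closedFieldType.

Lemma exists_notin (s : seq k) : exists u, u \notin s.
Proof.
have /closed_nonrootP[u] : \prod_(a <- s) ('X - a%:P) != 0.
  exact/monic_neq0/monic_prod_XsubC.
by rewrite root_prod_XsubC => su; exists u.
Qed.

Lemma exists_eigenvalue n (A : 'M[k]_n) :
  (0 < n)%N -> exists a, eigenvalue A a.
Proof.
move=> n_gt0; have /closed_rootP[a Aa] : size (char_poly A) != 1%N.
  by rewrite size_char_poly eqSS -lt0n.
by exists a; rewrite eigenvalue_root_char.
Qed.

Lemma mxrank_pencil_generic m n (A B : 'M[k]_(m, n)) :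
  exists s : seq k, forall u, u \notin s -> (\rank A <= \rank (A + u *: B)%R)%N.
Proof.
have /row_fullP[L LA] := col_base_full A.
have /row_freeP[R AR] := row_base_free A.
have LAR : L *m A *m R = 1%:M.
  transitivity (L *m (col_base A *m row_base A) *m R).
    by rewrite mulmx_base.
  by rewrite mulmxA LA mul1mx AR.
pose N := L *m B *m R.
have [r charN] := closed_field_poly_normal (char_poly N).
exists [seq - a^-1 | a <- r] => u nu.
have LARu : L *m (A + u *: B) *m R = 1%:M + u *: N.
  by rewrite mulmxDr mulmxDl LAR -scalemxAr -scalemxAl.
suff full : row_free (1%:M + u *: N).
  apply: (@leq_trans (\rank (1%:M + u *: N)%R)); first by rewrite (eqP full).
  by rewrite -LARu (leq_trans (mxrankM_maxl _ _)) ?mxrankM_maxr.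
rewrite -kermx_eq0; apply: contraR nu => /rowV0Pn[v /sub_kermxP vN v0].
have eN : u *: (v *m N) = - v.
  by apply/eqP; rewrite -addr_eq0 addrC scalemxAr -{1}[v]mulmx1 -mulmxDr vN.
have u0 : u != 0.
  by apply: contraNneq v0 => u0; rewrite -oppr_eq0 -eN u0 scale0r.
apply/mapP; exists (- u^-1); last by rewrite invrN invrK opprK.
rewrite (monicP (char_poly_monic N)) scale1r in charN.
rewrite -root_prod_XsubC -charN -eigenvalue_root_char.
apply/eigenvalueP; exists v => //.
by rewrite scaleNr -scalerN -eN scalerA mulVf// scale1r.
Qed.

Lemma submx_pencil_limit m n q (A B : 'M[k]_(m, n)) (D : 'M_(q, n))
    (s : seq k) :
  (forall u, \rank (A + u *: B)%R <= \rank A)%N ->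
  (forall u, u \notin s -> (D <= (A + u *: B)%R)%MS) -> (D <= A)%MS.
Proof.
move=> rAB DAB.
have [s' gen] := mxrank_pencil_generic (col_mx A D) (col_mx B 0).
have [u] := exists_notin (s ++ s'); rewrite mem_cat negb_or => /andP[su s'u].
have := gen u s'u; rewrite scale_col_mx add_col_mx scaler0 addr0.
rewrite -!addsmxE => rAD.
suff : (A + D <= A)%MS by rewrite addsmx_sub => /andP[].
rewrite -(mxrank_leqif_sup (addsmxSl A D)) eqn_leq mxrankS ?addsmxSl//=.
apply: leq_trans rAD (leq_trans _ (rAB u)); apply: mxrankS.
by rewrite addsmx_sub submx_refl DAB.
Qed.

(* Describes the tangent space at A of the variety of matrices of rank at most
   that of A. *)
Lemma kermx_pencil_sub m n (A B : 'M[k]_(m, n)) :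
  (forall u, \rank (A + u *: B)%R <= \rank A)%N -> (kermx A *m B <= A)%MS.
Proof.
move=> rAB; apply: (@submx_pencil_limit _ _ _ A B _ [:: 0]) => // u.
rewrite inE => u0; rewrite -(eqmx_scale _ u0) scalemxAr.
have -> : kermx A *m (u *: B) = kermx A *m (A + u *: B).
  by rewrite mulmxDr mulmx_ker add0r.
exact: submxMl.
Qed.

(* If a nonzero D lies in the row space of almost all P + u Q, then D = E P and
   the rows of E Q have the same property. So a D of maximal rank satisfies
   E Q = F E P, and an eigenvector of F contradicts freeness of Q - a P. *)
Lemma row_free_pencil_meet0 r n q (P Q : 'M[k]_(r, n)) (D : 'M_(q, n))
    (s : seq k) :
  row_free P -> (forall a, row_free (Q - a *: P)) ->
  (forall u, u \notin s -> (D <= (P + u *: Q)%R)%MS) -> D = 0.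
Proof.
move=> freeP freeQ.
have [c] := ubnP (n - \rank D)%N.
elim: c => // c IHc in q D s * => ltc DPQ.
wlog freeD : q D ltc DPQ / row_free D.
  move=> wlogD; apply/eqP; rewrite -submx0 -(eq_row_base D) submx0; apply/eqP.
  apply: wlogD; rewrite ?row_base_free ?eq_row_base//.
  by move=> u su; rewrite eq_row_base DPQ.
have /submxP[E DE] : (D <= P)%MS.
  apply: (submx_pencil_limit _ DPQ) => u.
  by rewrite (eqP freeP) rank_leq_row.
have EQ u : u \notin 0 :: s -> (E *m Q <= (P + u *: Q)%R)%MS.
  rewrite inE negb_or => /andP[u0 su].
  rewrite -(eqmx_scale _ u0) scalemxAr.
  have -> : E *m (u *: Q) = E *m (P + u *: Q) - D.
    by rewrite mulmxDr -DE addrAC subrr add0r.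
  by rewrite addmx_sub ?submxMl// eqmx_opp DPQ.
have DEQ u : u \notin 0 :: s -> (col_mx D (E *m Q) <= (P + u *: Q)%R)%MS.
  move=> su; rewrite -addsmxE addsmx_sub EQ// DPQ//.
  by move: su; rewrite inE negb_or => /andP[].
have [/submxP[F EF]|nsub] := boolP (E *m Q <= D)%MS.
  have [q0|q_gt0] := posnP q.
    by apply/eqP; rewrite -mxrank_eq0 (eqP freeD) q0.
  have [a /eigenvalueP[v vF v0]] := exists_eigenvalue F q_gt0.
  have : v *m E *m (Q - a *: P) = 0.
    rewrite mulmxBr -scalemxAr -!mulmxA EF -DE mulmxA vF -scalemxAl.
    by rewrite DE mulmxA subrr.
  move/eqP; rewrite mulmx_free_eq0 // => /eqP vE.
  move: v0; rewrite -(mulmx_free_eq0 _ freeD) DE mulmxA vE mul0mx eqxx //.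
have ltD : (\rank D < \rank (D + E *m Q)%MS)%N.
  rewrite ltn_neqAle mxrankS ?addsmxSl// andbT.
  by rewrite (mxrank_leqif_sup (addsmxSl _ _)) addsmx_sub submx_refl.
suff : col_mx D (E *m Q) = 0.
  by rewrite -[0]col_mx0 => /eq_col_mx[].
apply: (IHc _ _ (0 :: s)) => //; rewrite -addsmxE.
rewrite ltnS in ltc; apply: leq_trans ltc; apply: ltn_sub2l => //.
exact: leq_trans ltD (rank_leq_col _).
Qed.

Lemma row_free_tr_of_rank_mulmx m n r (X1 : 'M[k]_(m, r)) (V : 'M_(r, n)) :
  \rank (X1 *m V) = r -> row_free X1^T.
Proof.
move=> rXV; rewrite /row_free mxrank_tr eqn_leq rank_leq_col/=.
by rewrite -{1}rXV mxrankM_maxl.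
Qed.

(* Functionals vanishing on im X, pulled back along Z, kill the kernel of every
   X + u Y by [kermx_pencil_sub]; hence they vanish by [row_free_pencil_meet0]
   applied to the transposed pencil. *)
Lemma submx_net m (X Y Z : 'M[k]_m) :
  (Y <= X)%MS ->
  (forall a, \rank (Y + a *: X)%R = \rank X) ->
  (forall a b, \rank (X + a *: Y + b *: Z)%R = \rank X) ->
  (Z <= X)%MS.
Proof.
move=> sYX rYX rXYZ; pose V := row_base X.
pose c (W : 'M[k]_m) := W *m pinvmx V.
have cK W : (W <= X)%MS -> c W *m V = W.
  by move=> sWX; rewrite mulmxKpV// eq_row_base.
have rXY u : \rank (X + u *: Y)%R = \rank X.
  by rewrite -(rXYZ u 0) scale0r addr0.
have sXY u : ((X + u *: Y)%R <= X)%MS.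
  by rewrite addmx_sub ?submx_refl ?scalemx_sub.
rewrite submxE -trmx_eq0; apply/eqP.
apply: (@row_free_pencil_meet0 _ _ _ (c X)^T (c Y)^T _ [::]).
- by apply: (@row_free_tr_of_rank_mulmx _ _ _ _ V); rewrite cK.
- move=> a; rewrite -linearZ -linearB /=.
  apply: (@row_free_tr_of_rank_mulmx _ _ _ _ V).
  by rewrite mulmxBl -scalemxAl !cK// -scaleNr rYX.
move=> u _; rewrite -linearZ -linearD /=.
set N := _ + _; pose C := Z *m cokermx X.
have NV : N *m V = X + u *: Y by rewrite mulmxDl -scalemxAl !cK.
have kerC : kermx N *m C = 0.
  have : (kermx (X + u *: Y) *m Z <= X)%MS.
    apply: submx_trans (sXY u); apply: kermx_pencil_sub => b.
    by rewrite rXYZ rXY.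
  rewrite submxE -mulmxA => /eqP kC.
  have /submxP[W ->] : (kermx N <= kermx (X + u *: Y))%MS.
    by apply/sub_kermxP; rewrite -NV mulmxA mulmx_ker mul0mx.
  by rewrite -mulmxA kC mulmx0.
have /submxP[W eW] : ((1%:M - N *m pinvmx N)%R <= kermx N)%MS.
  by apply/sub_kermxP; rewrite mulmxBl mul1mx mulmxKpV// subrr.
rewrite -/C; have -> : C = N *m (pinvmx N *m C).
  apply/eqP; rewrite -subr_eq0 mulmxA -{1}[C]mul1mx -mulmxBl eW -mulmxA kerC.
  by rewrite mulmx0.
by rewrite trmx_mul submxMl.
Qed.

End Pencils.

Section Engel.
Variables (k : fieldType) (g : lieAlgebra k).
Local Notation "[ x , y ]" := (bracket x y).

Lemma bracketDl (x y z : g) : [x + y, z] = [x, z] + [y, z].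
Proof. by have := bracket_linl z 1 x y; rewrite !scale1r. Qed.

Lemma bracketDr (x y z : g) : [x, y + z] = [x, y] + [x, z].
Proof. by have := bracket_linr x 1 y z; rewrite !scale1r. Qed.

Lemma bracket0l (z : g) : [0, z] = 0.
Proof. by apply: (addrI [0, z]); rewrite -bracketDl !addr0. Qed.

Lemma bracket0r (z : g) : [z, 0] = 0.
Proof. by apply: (addrI [z, 0]); rewrite -bracketDr !addr0. Qed.

Lemma bracketZl a (x z : g) : [a *: x, z] = a *: [x, z].
Proof. by have := bracket_linl z a x 0; rewrite bracket0l !addr0. Qed.

Lemma bracketZr a (x z : g) : [z, a *: x] = a *: [z, x].
Proof. by have := bracket_linr z a x 0; rewrite bracket0r !addr0. Qed.

Lemma bracketC (x y : g) : [x, y] = - [y, x].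
Proof.
apply/eqP; rewrite -addr_eq0; have := bracket_alt (x + y).
by rewrite bracketDl !bracketDr !bracket_alt add0r addr0 => ->.
Qed.

Lemma bracketNr (x z : g) : [z, - x] = - [z, x].
Proof. by rewrite -scaleN1r bracketZr scaleN1r. Qed.

Lemma bracketA (x y z : g) : [x, [y, z]] = [[x, y], z] + [y, [x, z]].
Proof.
apply/eqP; rewrite -subr_eq0 opprD -(bracketC z [x, y]) -[- [y, _]]bracketNr.
by rewrite -(bracketC z x) addrA addrAC bracket_jacobi.
Qed.

(* Engel's theorem for the adjoint action on subquotients W2 / W1 of g; taking
   W1 to be the subalgebra itself and W2 = g, it also produces the element that
   enlarges the subalgebra in the induction step. *)
Lemma engel_subalgebra (n : nat) :
  (forall x : g, exists i, forall y, iter i (bracket x) y = 0) ->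
  (n <= \dim {:g})%N ->
  exists2 h : {vspace g}, \dim h = n /\ {in h &, forall x y, [x, y] \in h} &
    forall W1 W2 : {vspace g},
      {in h & W1, forall x w, [x, w] \in W1} ->
      {in h & W2, forall x w, [x, w] \in W2} ->
      ~~ (W2 <= W1)%VS ->
      exists2 w, w \in W2 & w \notin W1 /\ {in h, forall x, [x, w] \in W1}.
Proof.
move=> ad_nil; elim: n => [_|n IHn lt_n].
  exists 0%VS; first split; first exact: dimv0.
    by move=> x y /[!memv0] /eqP-> _; rewrite bracket0l.
  move=> W1 W2 _ _ /subvPn[w W2w W1w]; exists w; first by [].
  by split=> // x /[!memv0] /eqP->; rewrite bracket0l mem0v.
have [h [dim_h h_sub] engel_h] := IHn (ltnW lt_n).
have [||| u _ [hu uh]] := engel_h h fullv.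
- exact: h_sub.
- by move=> *; apply: memvf.
- by apply: contraTN lt_n => /dimvS; rewrite dim_h -leqNgt.
pose h' := (h + <[u]>)%VS.
have h'P x : x \in h' -> exists2 y, y \in h & exists a, x = y + a *: u.
  by case/memv_addP=> y hy [_ /vlineP[a ->] ->]; exists y => //; exists a.
have hu_h x : x \in h -> [u, x] \in h.
  by move=> hx; rewrite bracketC rpredN uh.
have sh : (h <= h')%VS by apply: addvSl.
have uh' : u \in h' by apply: (subvP (addvSr _ _)); apply: memv_line.
exists h'; first split.
- rewrite dimv_disjoint_sum ?dim_h ?dim_vline.
    case: eqVneq hu => [->|_ _]; [by rewrite mem0v | by rewrite addn1].
  apply/eqP; rewrite -subv0; apply/subvP=> v /memv_capP[hv /vlineP[a va]].
  have [a0|a0] := eqVneq a 0; first by rewrite va a0 scale0r mem0v.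
  by rewrite va in hv; rewrite -(scalerK a0 u) rpredZ in hu.
- move=> x y /h'P[x' hx [a ->]] /h'P[y' hy [b ->]].
  rewrite bracketDl !bracketDr !bracketZl !bracketZr bracket_alt !scaler0 addr0.
  apply: (subvP sh); apply: rpredD; last by rewrite rpredZ ?hu_h.
  by rewrite rpredD ?h_sub// rpredZ ?uh.
move=> W1 W2 hW1 hW2 nsub.
have [|| // |w W2w [W1w hw]] := engel_h W1 W2.
- by move=> x y hx; apply/hW1/(subvP sh).
- by move=> x y hx; apply/hW2/(subvP sh).
have [i ui] := ad_nil u; have {ui} := ui w.
elim: i => [|i IHi] in w W2w W1w hw *.
  by move=> /= w0; rewrite w0 mem0v in W1w.
rewrite iterSr => uiw; have [W1uw|W1uw] := boolP ([u, w] \in W1).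
  exists w => //; split=> // x /h'P[y hy [a ->]].
  by rewrite bracketDl bracketZl rpredD ?rpredZ// hw.
apply: (IHi [u, w]) => //; first exact: hW2.
move=> x hx; rewrite bracketA rpredD ?hw ?uh//.
by rewrite hW1 ?hw.
Qed.

Lemma engel_center :
  (forall x : g, exists i, forall y, iter i (bracket x) y = 0) ->
  (0 < \dim {:g})%N -> exists2 z : g, z != 0 & forall x, [x, z] = 0.
Proof.
move=> ad_nil g_gt0.
have [h [dim_h _] engel_h] := engel_subalgebra ad_nil (leqnn _).
have hT : h = fullv by apply/eqP; rewrite eqEdim subvf dim_h leqnn.
have [||| z _ [z0 hz]] := engel_h 0%VS fullv.
- by move=> x y _ /[!memv0] /eqP->; rewrite bracket0r.
- by move=> *; apply: memvf.
- by rewrite subv0 -dimv_eq0 -lt0n.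
exists z; first by rewrite memv0 in z0.
by move=> x; apply/eqP; rewrite -memv0 hz// hT memvf.
Qed.

End Engel.

Section Limg.
Import VectorInternalTheory.

Lemma mul_f2mx (k : fieldType) (V W : vectType k) (f : 'Hom(V, W)) u :
  u *m f2mx f = v2r (f (r2v u)).
Proof. by rewrite unlock /= !r2vK. Qed.

Lemma f2mx_linear (k : fieldType) (V W : vectType k) : linear (@f2mx k V W).
Proof.
move=> a f h; apply/row_matrixP=> i; rewrite !rowE mulmxDr -scalemxAr !mul_f2mx.
by rewrite add_lfunE scale_lfunE linearP.
Qed.

HB.instance Definition _ (k : fieldType) (V W : vectType k) :=
  GRing.isLinear.Build k 'Hom(V, W) _ _ (@f2mx k V W) (@f2mx_linear k V W).

Lemma vs2mx_limg (k : fieldType) (V W : vectType k) (f : 'Hom(V, W)) :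
  (vs2mx (limg f) :=: f2mx f)%MS.
Proof.
rewrite unlock /lfun_img_def; apply: eqmx_trans (mx2vsK _) _.
apply: eqmxMfull; rewrite -sub1mx.
by have := subvf (mx2vs (1%:M : 'M[k]_(dim V))); rewrite /subsetv genmxE.
Qed.

Lemma subv_limg (k : fieldType) (V W : vectType k) (f h : 'Hom(V, W)) :
  (limg f <= limg h)%VS = (f2mx f <= f2mx h)%MS.
Proof. by rewrite /subsetv !vs2mx_limg. Qed.

Lemma dim_limg (k : fieldType) (V W : vectType k) (f : 'Hom(V, W)) :
  \dim (limg f) = \rank (f2mx f).
Proof. by rewrite /dimv vs2mx_limg. Qed.

Lemma limg_net (k : closedFieldType) (M : vectType k) (X Y Z : 'End(M)) :
  (limg Y <= limg X)%VS ->
  (forall a, \dim (limg (Y + a *: X)) = \dim (limg X)) ->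
  (forall a b, \dim (limg (X + a *: Y + b *: Z)) = \dim (limg X)) ->
  (limg Z <= limg X)%VS.
Proof.
rewrite !subv_limg => sYX rYX rXYZ; apply: submx_net sYX _ _ => [a|a b].
  by rewrite -!dim_limg -(rYX a) dim_limg linearD linearZ.
by rewrite -!dim_limg -(rXYZ a b) dim_limg !linearD !linearZ.
Qed.

End Limg.

Section RestrictedModules.
Variables (k : closedFieldType) (p : nat) (g : restrictedLieAlgebra k p).
Variable M : fdModule (res_env_alg g).

Lemma opM_linear : linear (opM M).
Proof.
move=> a x y; apply/lfunP=> m; rewrite add_lfunE scale_lfunE !lfunE /=.
rewrite res_env_in_linear.
exact: (fd_act_linl m a (res_env_in x) (res_env_in y)).
Qed.

HB.instance Definition _ := GRing.isLinear.Build k g 'End(M) _ (opM M)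
  opM_linear.

Lemma opM_central (z x : g) :
  bracket x z = 0 -> (opM M x \o opM M z = opM M z \o opM M x)%VF.
Proof.
move=> xz; have in0 : res_env_in (0 : g) = 0.
  have := res_env_in_linear (-1) (0 : g) 0.
  by rewrite scaler0 addr0 scaleN1r addNr.
have := res_env_in_bracket x z; rewrite xz in0 => /esym/eqP.
rewrite subr_eq0 => /eqP xzC; apply/lfunP=> m.
by rewrite !comp_lfunE !lfunE /= -!fd_actM xzC.
Qed.

Lemma limg_opM_sub (x y : g) :
  constant_rank M -> free [:: x; y] -> (limg (opM M y) <= limg (opM M x))%VS ->
  forall z, (limg (opM M z) <= limg (opM M x))%VS.
Proof.
move=> rkM xy_free sYX z.
have y_notin : y \notin <[x]>%VS.
  move: xy_free; rewrite -(perm_free (permEl (perm_catC [:: y] [:: x]))).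
  by rewrite free_cons span_seq1 => /andP[].
have x0 : x != 0.
  by apply: contraTneq xy_free => ->; rewrite free_cons mem0v.
have [|z_notin] := boolP (z \in <<[:: x; y]>>%VS).
  rewrite span_cons span_seq1.
  case/memv_addP=> _ /vlineP[a ->] [_ /vlineP[b ->] ->].
  apply/subvP=> _ /memv_imgP[m _ ->]; rewrite linearD !linearZ.
  rewrite add_lfunE !scale_lfunE rpredD ?rpredZ ?memv_img ?memvf//.
  by apply: (subvP sYX); rewrite memv_img ?memvf.
apply: limg_net sYX _ _ => [a|a b].
  rewrite -linearZ -linearD; apply: rkM => //.
  apply: contraNneq y_notin => /eqP; rewrite addr_eq0 => /eqP->.
  by rewrite rpredN rpredZ ?memv_line.
rewrite -!linearZ -!linearD; apply: rkM => //.
have [->|b0] := eqVneq b 0.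
  rewrite scale0r addr0; have [->|a0] := eqVneq a 0.
    by rewrite scale0r addr0.
  apply: contraNneq y_notin => /eqP; rewrite addrC addr_eq0 => /eqP e.
  by rewrite -(scalerK a0 y) e rpredZ ?rpredN ?memv_line.
apply: contraNneq z_notin => /eqP; rewrite addrC addr_eq0 => /eqP e.
rewrite -(scalerK b0 z) e rpredZ// rpredN rpredD ?rpredZ//.
  by rewrite memv_span// mem_head.
by rewrite memv_span// !inE eqxx orbT.
Qed.

Lemma limg_opM_exp (z x : g) j :
  (forall y, bracket y z = 0) -> limg (opM M x) = limg (opM M z) ->
  limg (opM_exp M x j) = limg (opM_exp M z j).
Proof.
move=> cz xz.
have expS y i : opM_exp M y i.+1 = (opM M y \o opM_exp M y i)%VF by [].
have expC i : (opM M x \o opM_exp M z i = opM_exp M z i \o opM M x)%VF.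
  elim: i => [|i IHi]; first by rewrite comp_lfun1l comp_lfun1r.
  by rewrite expS comp_lfunA opM_central// -comp_lfunA IHi comp_lfunA.
have expzC i : (opM_exp M z i \o opM M z = opM_exp M z i.+1)%VF.
  elim: i => [|i IHi]; first by rewrite /opM_exp /= comp_lfun1l comp_lfun1r.
  by rewrite [LHS]/= -comp_lfunA IHi.
elim: j => // j IHj; rewrite expS limg_comp IHj -limg_comp expC limg_comp xz.
by rewrite -limg_comp expzC.
Qed.

End RestrictedModules.

Theorem proposition7p1 (k : closedFieldType) (p : nat) (hp : p \in [pchar k])
    (g : restrictedLieAlgebra k p) (hg : p_trivial g)
    (M : fdModule (res_env_alg g)) (hM : constant_rank M)
    (hxy : exists x y : g, [/\ x != 0, y != 0, free [:: x; y]
                             & limg (opM M x) = limg (opM M y)]) :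
  equal_images_property M.
Proof.
have [x [y [x0 _ xy_free xyE]]] := hxy.
have img_eq z : z != 0 -> limg (opM M z) = limg (opM M x).
  move=> z0; apply/eqP; rewrite eqEdim (hM x z x0 z0) leqnn andbT.
  by apply: (limg_opM_sub hM xy_free); rewrite xyE subvv.
have [||z z0 cz] := @engel_center k g.
- move=> u; exists p => v; rewrite -p_power_ad hg; exact: bracket0l.
- rewrite lt0n; apply: contraNneq x0 => /eqP; rewrite dimv_eq0 => /eqP g0.
  by rewrite -memv0 -g0 memvf.
move=> u v j u0 v0 _.
by rewrite !(limg_opM_exp _ cz) ?(img_eq z) ?img_eq.
Qed.
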